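(* Let $d\ge 1$. Let $F\colon\mathbb{R}\to\left]-\infty,+\infty\right]$ be a lower semicontinuous convex function such that the interior of $\operatorname{dom}F$ is $\left]0,+\infty\right[$, $F$ is differentiable in $\left]0,+\infty\right[$, and $L_0:=\lim_{\xi\downarrow 0}F'(\xi)\in\mathbb{R}\cup\{-\infty\}$. Let $\Psi\colon\mathbb{R}\times\mathbb{R}^d\to\left]-\infty,+\infty\right]$ be given by $\Psi(\rho,\boldsymbol{m})=F(\rho)$. Let $\phi\colon\mathbb{R}\to\left]-\infty,+\infty\right]$ be even, convex, lower semicontinuous, differentiable in the interior of $\operatorname{dom}\phi$, such that $\phi(\xi)=0$ if and only if $\xi=0$, and suppose that one of the following holds: (i) $\operatorname{dom}\phi=\mathbb{R}$, $\lim_{\xi\to-\infty}\phi'(\xi)=-\infty$, and $\lim_{\xi\to+\infty}\phi'(\xi)=+\infty$; or (ii) there is $a\in\left]0,+\infty\right[$ such that $\operatorname{dom}\phi=[-a,a]$, $\lim_{\xi\to-a}\phi'(\xi)=-\infty$, and $\lim_{\xi\to a}\phi'(\xi)=+\infty$ (limits taken from within $\left]-a,a\right[$). Define $\Phi\colon\mathbb{R}\times\mathbb{R}^d\to\left]-\infty,+\infty\right]$ by $$\Phi(\rho,\boldsymbol{m})=\begin{cases}\rho\,\phi\left(\dfrac{|\boldsymbol{m}|}{\rho}\right),&\text{if }\rho>0;\\ 0,&\text{if }(\rho,\boldsymbol{m})=(0,0);\\ +\infty,&\text{otherwise}.\end{cases}$$ Then, for every $\gamma>0$ and every $(\rho,\boldsymbol{m})\in\mathbb{R}\times\mathbb{R}^d$,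 $$\operatorname{Prox}_{\gamma(\Phi+\Psi)}(\rho,\boldsymbol{m})=\begin{cases}(0,0),&\text{if }\rho+\gamma\phi^*\left(\dfrac{|\boldsymbol{m}|}{\gamma}\right)\le\gamma L_0;\\[3mm](\theta,\boldsymbol{v}),&\text{if }\rho+\gamma\phi^*\left(\dfrac{|\boldsymbol{m}|}{\gamma}\right)>\gamma L_0,\end{cases}$$ where, in the second case, $\theta\ge\operatorname{Prox}_{\gamma F}\rho\ge 0$ is the unique strictly positive solution $t=\theta$ to $R(t)=0$, with $$R(t)=t+\gamma F'(t)-\rho-\gamma\,\phi^*\left(\operatorname{Prox}_{\frac{t}{\gamma}\phi^*}\left(\frac{|\boldsymbol{m}|}{\gamma}\right)\right),\qquad t>0,$$ and $$\boldsymbol{v}=\begin{cases}\left(1-\dfrac{\gamma}{|\boldsymbol{m}|}\operatorname{Prox}_{\frac{\theta}{\gamma}\phi^*}\left(\dfrac{|\boldsymbol{m}|}{\gamma}\right)\right)\boldsymbol{m},&\text{if }\boldsymbol{m}\ne 0;\\ 0,&\text{if }\boldsymbol{m}=0.\end{cases}$$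
   Context: $|\cdot|$ denotes the Euclidean norm (on $\mathbb{R}^d$, $\mathbb{R}\times\mathbb{R}^d$, or $\mathbb{R}$). For $f\colon\mathbb{R}^M\to\left]-\infty,+\infty\right]$, $\operatorname{dom}f=\{x: f(x)<+\infty\}$ and $f^*(u)=\sup_{x\in\mathbb{R}^M}(u^\top x-f(x))$ is the Fenchel conjugate. For $f$ proper, convex and lower semicontinuous, the proximity operator is $\operatorname{Prox}_f x=\arg\min_{y\in\mathbb{R}^M}\big(f(y)+\tfrac12|y-x|^2\big)$, which is the unique minimizer. The inequality $\,\cdot\le\gamma L_0$ is never satisfied by a real number when $L_0=-\infty$ (so the second case always applies then). *)

(* Defs.v *)
From HB Require Import structures.
From mathcomp Require Import all_boot all_order all_algebra.
From mathcomp Require Import all_classical all_reals all_analysis.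

Set Implicit Arguments.
Unset Strict Implicit.
Unset Printing Implicit Defensive.

Import Order.TTheory GRing.Theory Num.Theory.
Import numFieldNormedType.Exports.

Local Open Scope classical_set_scope.
Local Open Scope ring_scope.
Local Open Scope ereal_scope.

Definition edom {T : Type} {R : realType} (f : T -> \bar R) : set T :=
  [set x | f x < +oo].

(* Meant for functions that avoid -oo; since 0 * +oo = 0 in \bar R, the cases
   t = 0 and t = 1 impose nothing. *)
Definition econvex {R : realType} {V : lmodType R} (f : V -> \bar R) : Prop :=
  forall (x y : V) (t : R), (0 <= t <= 1)%R ->
    f (t *: x + (1 - t) *: y)%R <= t%:E * f x + (1 - t)%:E * f y.

(* F' for extended-valued F; meaningful only in the interior of edom F. *)
Definition ederiv {R : realType} (F : R -> \bar R) (x : R) : R :=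
  derive1 (fine \o F) x.

Definition ediff_on {R : realType} (A : set R) (F : R -> \bar R) : Prop :=
  forall x, A x -> derivable (fine \o F) x 1%R.

Definition fenchel {R : realType} (f : R -> \bar R) (u : R) : \bar R :=
  ereal_sup [set (u * x)%:E - f x | x in [set: R]].

(* The library norm on row vectors is the sup norm, and the one on pairs is the
   max of the components; both have to be replaced by Euclidean ones. *)
Definition l2norm {R : realType} {d : nat} (m : 'rV[R]_d) : R :=
  Num.sqrt (\sum_(i < d) m ord0 i ^+ 2)%R.

Definition l2norm_pair {R : realType} {d : nat} (p : R * 'rV[R]_d) : R :=
  Num.sqrt (p.1 ^+ 2 + l2norm p.2 ^+ 2)%R.

Definition absr {R : realType} (x : R) : R := `|x|%R.

Definition argmin {T : Type} {R : realType} (f : T -> \bar R) : set T :=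
  [set x | forall y, f x <= f y].

Definition Argprox {R : realType} {V : zmodType} (nrm : V -> R)
    (f : V -> \bar R) (x : V) : set V :=
  argmin (fun y => f y + (2^-1 * nrm (y - x) ^+ 2)%:E).

(* Proximity operator on the real line: the element of Argprox absr f x, which
   is a singleton when f is proper, convex and lower semicontinuous (for other
   f, the value is arbitrary). *)
Definition prox {R : realType} (f : R -> \bar R) (x : R) : R :=
  xget 0%R (Argprox absr f x).

Definition escale {T : Type} {R : realType} (c : R) (f : T -> \bar R) :
  T -> \bar R := fun x => c%:E * f x.

Definition Psi {R : realType} {d : nat} (F : R -> \bar R)
  (p : R * 'rV[R]_d) : \bar R := F p.1.

Definition Phi {R : realType} {d : nat} (phi : R -> \bar R)
    (p : R * 'rV[R]_d) : \bar R :=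
  if (0 < p.1)%R then p.1%:E * phi (l2norm p.2 / p.1)%R
  else if p == (0%R, 0%R) then 0 else +oo.

Definition steep_line {R : realType} (phi : R -> \bar R) : Prop :=
  [/\ edom phi = [set: R],
      ederiv phi x @[x --> -oo%R] --> -oo%R &
      ederiv phi x @[x --> +oo%R] --> +oo%R].

Definition steep_segment {R : realType} (phi : R -> \bar R) : Prop :=
  exists a : R,
  [/\ (0 < a)%R,
      edom phi = `[(- a)%R, a]%classic,
      ederiv phi x @[x --> (- a)%R^'+] --> -oo%R &
      ederiv phi x @[x --> a^'-] --> +oo%R].

(* The function R(t); it takes values in \bar R because phi^* does. *)
Definition residual {R : realType} (F phi : R -> \bar R) (gamma rho z t : R) :
    \bar R :=
  (t + gamma * ederiv F t - rho)%:E
  - gamma%:E * fenchel phi (prox (escale (t / gamma) (fenchel phi)) z).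

(* Main.v *)
Require Import Defs.
From HB Require Import structures.
From mathcomp Require Import all_boot all_order all_algebra.
From mathcomp Require Import all_classical all_reals all_analysis.
From mathcomp Require Import ring lra.

Import Order.TTheory GRing.Theory Num.Theory.
Import numFieldNormedType.Exports.

Local Open Scope classical_set_scope.
Local Open Scope ring_scope.

(** The objective is convex, and a point is its minimizer as soon as affine
    minorants of [phi] and [F] there balance the gradient of the quadratic term.
    All convexity enters through subgradients, so neither the joint convexity of
    the perspective function nor a general existence theorem for proximal points
    is needed.

    For [z = |m| / gamma] and a weight [c >= 0], continuity of [phi'] and the
    steepness of [phi] give [s >= 0] and [p = phi' s >= 0] with [p + c * s = z]
    ([subgrad_solve]). Then [s] is a subgradient of the conjugate at [p], so for
    [c > 0] the point [p] is the proximal point of [c phi^*] at [z]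
    ([prox_subgrad]). As a function of [c], the value [phi^* p] is nonincreasing
    and Lipschitz ([resolvent_le]), with value [phi^* z] at [c = 0]. Hence
    [R(t) = t + gamma F'(t) - rho - gamma phi^*(p)], where [c = t / gamma], is
    strictly increasing and continuous, tends to infinity, and is negative near
    0 exactly above the threshold; there it has a unique zero [theta].

    At [theta], Fenchel-Young for [p] bounds the perspective function below by a
    linear function of [(rho, |m|)], the tangent of [F] at [theta] bounds [F],
    and Cauchy-Schwarz reduces optimality to a one-dimensional quadratic identity
    ([Argprox_interior]). Below the threshold the same estimate, with slope [z]
    and with the limit slope of [F] at 0 (a subgradient there, by lower
    semicontinuity, [lim_slope_le]), makes the origin optimal
    ([Argprox_origin]). *)

(** * Subgradients of extended-valued functions on the line *)

(** The slope [p] is a subgradient of [f] at [x]; the finiteness of [f x],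
    which makes [fine (f x)] its actual value, is part of the notion. *)
Definition subgrad {R : realType} (f : R -> \bar R) (x p : R) : Prop :=
  f x \is a fin_num /\ forall y, ((fine (f x) + p * (y - x))%:E <= f y)%E.

Lemma subgrad_fine {R : realType} {f : R -> \bar R} {x p : R} :
  subgrad f x p -> f x = (fine (f x))%:E.
Proof. by case=> fx _; rewrite fineK. Qed.

Lemma subgrad_le {R : realType} {f : R -> \bar R} {x p y : R} :
  subgrad f x p -> f y \is a fin_num ->
  fine (f x) + p * (y - x) <= fine (f y).
Proof. by case=> _ /(_ y) + /fineK fy; rewrite -fy lee_fin. Qed.

Lemma subgrad_mono {R : realType} {f : R -> \bar R} {x y p q : R} :
  subgrad f x p -> subgrad f y q -> 0 <= (p - q) * (x - y).
Proof.
move=> fp fq; have := subgrad_le fp (proj1 fq); have := subgrad_le fq (proj1 fp).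
nra.
Qed.

Lemma cvg_derive1 {R : realType} (f : R -> R) (x : R) : derivable f x 1 ->
  h^-1 * (f (h + x) - f x) @[h --> 0^'] --> derive1 f x.
Proof.
rewrite /derivable derive1E /derive => df.
have -> : (fun h : R => h^-1 * (f (h + x) - f x)) =
    (fun h : R => h^-1 *: ((f \o shift x) (h *: (1 : R)) - f x)).
  by apply/funext => h /=; rewrite /GRing.scale /= mulr1.
exact: df.
Qed.

(** The derivative of a convex function at an interior point of its domain is
    a subgradient: along the segment towards [y] the difference quotients are
    bounded by the slope of the chord. *)
Lemma subgrad_ederiv {R : realType} {f : R -> \bar R} {x : R} :
  (forall y, f y != -oo%E) -> econvex (f : R^o -> \bar R) ->
  f x \is a fin_num -> derivable (fine \o f) x 1 -> subgrad f x (ederiv f x).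
Proof.
move=> fNy fcvx fx df; split=> // y.
case fy: (f y) => [b| |]; [|by rewrite leey|by move: (fNy y); rewrite fy].
have ffy : f y \is a fin_num by rewrite fy.
have fxE := fineK fx; set a := fine (f x) in fxE *.
rewrite lee_fin leNgt; apply/negP => ba.
have yx : y - x != 0 by apply/eqP => e; move: ba fy; rewrite e mulr0 addr0
  (subr0_eq e) -fxE => + [ab]; rewrite ab ltxx.
have chord t : 0 <= t <= 1 ->
    fine (f (t * (y - x) + x)) - a <= t * (b - a).
  move=> t01; have := fcvx y x t t01.
  rewrite fy -fxE -!EFinM -EFinD (_ : t *: _ + _ = t * (y - x) + x); last first.
    by rewrite /GRing.scale /=; ring.
  move: (fNy (t * (y - x) + x)); case: (f _) => [u| |]//= _.
  by rewrite lee_fin; lra.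
have /cvgr_gt/(_ (b - a)) : (y - x) * (h^-1 * ((fine \o f) (h + x) - a))
    @[h --> 0^'] --> (y - x) * ederiv f x.
  by apply: cvgM; [exact: cvg_cst|exact: (cvg_derive1 _ _ df)].
have /[swap]/[apply] : b - a < (y - x) * ederiv f x by move: ba; lra.
move=> /nbhs_ballP[e /= e0 He].
have v0 : 0 < `|y - x| by rewrite normr_gt0.
(* a step along the segment from x to y that stays in the ball of radius e *)
pose t := Num.min 1 (e / 2 / `|y - x|).
have t0 : 0 < t by rewrite lt_min ltr01/= !divr_gt0.
have tv0 : t * (y - x) != 0 by rewrite mulf_neq0// gt_eqF.
have := He (t * (y - x)); rewrite /ball /= sub0r normrN => /(_ _ tv0).
rewrite normrM (gtr0_norm t0) => /(_ _)/wrap[].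
  apply: (@le_lt_trans _ _ (e / 2)); last by lra.
  by rewrite -ler_pdivlMr// ge_min lexx orbT.
have := chord t; rewrite (ltW t0) ge_min lexx /= => /(_ isT).
rewrite ltNge => H /negP; apply.
rewrite invfM (mulrA (y - x)) mulrCA mulfV// mulr1 ler_pdivrMl//.
Qed.

(** The derivative of a function is continuous wherever nearby derivatives are
    subgradients: the slope at [y] is squeezed by chords with a fixed far end,
    and those chords depend continuously on [y]. *)
Lemma ederiv_continuous {R : realType} {f : R -> \bar R} {x : R} :
  derivable (fine \o f) x 1 ->
  (\forall y \near x, subgrad f y (ederiv f y)) ->
  {for x, continuous (ederiv f)}.
Proof.
move=> df nf; apply/cvgrPdist_lt => e e0.
have fc : {for x, continuous (fine \o f)}.
  by apply: differentiable_continuous; rewrite -derivable1_diffP.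
have /cvgr_dist_lt/(_ _ e0) := cvg_derive1 _ _ df.
move=> /nbhs_ballP[r /= r0 Hr].
have [r' /= r'0 Hr'] : exists2 r', 0 < r' &
    forall y, `|x - y| < r' -> subgrad f y (ederiv f y).
  by move/nbhs_ballP: nf => [r' /= r'0 H]; exists r'.
pose h := Num.min r r' / 2.
have m0 : 0 < Num.min r r' by rewrite lt_min r0.
have h0 : 0 < h by rewrite divr_gt0.
have hr : h < r /\ h < r'.
  by move: (ge_min (Num.min r r') r r'); rewrite lexx /h;
     case: (ltP r r') => ? _; split; lra.
have fin y : `|x - y| < r' -> f y \is a fin_num by move=> /Hr'[].
have fp : f (h + x) \is a fin_num.
  by apply: fin; rewrite distrC addrK gtr0_norm//; case: hr.
have fm : f (- h + x) \is a fin_num.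
  by apply: fin; rewrite distrC addrK normrN gtr0_norm//; case: hr.
have gap (u k : R) : (fun y => fine (f (u + x)) - fine (f y) - k * (u + x - y)) y
    @[y --> x] --> fine (f (u + x)) - fine (f x) - k * u.
  have -> : k * u = k * (u + x - x) by rewrite addrK.
  apply: cvgB; first by apply: cvgB => //; exact: cvg_cst.
  apply: cvgM; first exact: cvg_cst.
  by apply: cvgB; [exact: cvg_cst|exact: cvg_id].
have up : \forall y \near x,
    fine (f (h + x)) - fine (f y) - (ederiv f x + e) * (h + x - y) < 0.
  apply: (cvgr_lt _ (gap h (ederiv f x + e))).
  have := Hr h; rewrite /ball /= sub0r normrN gtr0_norm// => /(_ (proj1 hr)).
  rewrite gt_eqF// => /(_ isT); rewrite ltr_distlC => /andP[_].
  by rewrite ltr_pdivrMl// mulrC; rewrite /ederiv /=; lra.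
have dn : \forall y \near x,
    fine (f (- h + x)) - fine (f y) - (ederiv f x - e) * (- h + x - y) < 0.
  apply: (cvgr_lt _ (gap (- h) (ederiv f x - e))).
  have := Hr (- h); rewrite /ball /= sub0r opprK gtr0_norm// => /(_ (proj1 hr)).
  rewrite oppr_eq0 gt_eqF// => /(_ isT); rewrite ltr_distlC => /andP[+ _].
  by rewrite invrN mulNr ltrNr ltr_pdivrMl// mulrC; rewrite /ederiv /=; lra.
near=> y.
have sy : subgrad f y (ederiv f y) by near: y.
have yh : `|x - y| < h by near: y; exact: (@nbhsx_ballx R R x h).
have uy : fine (f (h + x)) - fine (f y) - (ederiv f x + e) * (h + x - y) < 0.
  by near: y.
have dy : fine (f (- h + x)) - fine (f y) - (ederiv f x - e) * (- h + x - y) < 0.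
  by near: y.
have := subgrad_le sy fp; have := subgrad_le sy fm.
move: yh; rewrite !ltr_distl => /andP[y1 y2] A B; apply/andP; split.
  have : (ederiv f y - (ederiv f x + e)) * (h + x - y) < 0 by lra.
  by rewrite pmulr_llt0; lra.
have : (ederiv f y - (ederiv f x - e)) * (- h + x - y) < 0 by lra.
by rewrite nmulr_llt0; lra.
Unshelve. all: by end_near.
Qed.

(** * Conjugates and proximity operators through subgradients *)

Lemma fenchel_subgrad {R : realType} {f : R -> \bar R} {x p : R} :
  subgrad f x p -> fenchel f p = (p * x - fine (f x))%:E.
Proof.
move=> fp; apply/eqP; rewrite eq_le; apply/andP; split.
  apply: ge_ereal_sup => _ [y _ <-]; have := proj2 fp y.
  case: (f y) => [b| |]//=; last by rewrite leNye.
  by rewrite !lee_fin; lra.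
apply: ereal_sup_ubound; exists x => //.
by rewrite {1}(subgrad_fine fp).
Qed.

Lemma fenchel_young {R : realType} (f : R -> \bar R) (x u : R) :
  f x \is a fin_num -> ((u * x - fine (f x))%:E <= fenchel f u)%E.
Proof.
by move=> fx; apply: ereal_sup_ubound; exists x => //; rewrite EFinB fineK.
Qed.

Lemma subgrad_fenchel {R : realType} {f : R -> \bar R} {x p : R} :
  subgrad f x p -> subgrad (fenchel f) p x.
Proof.
move=> fp; rewrite /subgrad (fenchel_subgrad fp) /=; split=> // y.
have := fenchel_young f x y (proj1 fp).
by apply: le_trans; rewrite lee_fin; lra.
Qed.

Lemma argmin_set1 {T : Type} {R : realType} (f : T -> \bar R) (p : T) (v : R) :
  f p = v%:E -> (forall y, y <> p -> (v%:E < f y)%E) -> argmin f = [set p].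
Proof.
move=> fp H; apply/seteqP; split=> [x /(_ p)|_ -> y] /=.
  rewrite fp leNgt => xp; have [//|ne] := pselect (x = p).
  by move: xp; rewrite H.
by rewrite fp; have [->|ne] := pselect (y = p); [rewrite fp|apply/ltW/H].
Qed.

(** [c * s] is the slope of [c * f] at [p], which the quadratic term balances. *)
Lemma Argprox_subgrad {R : realType} (f : R -> \bar R) (c p s z : R) :
  0 < c -> subgrad f p s -> p + c * s = z ->
  Argprox absr (escale c f) z = [set p].
Proof.
move=> c0 fp <-; apply: (@argmin_set1 _ _ _ _ (c * fine (f p) + 2^-1 * (c * s) ^+ 2)).
  rewrite /escale (subgrad_fine fp) /= -EFinM -EFinD /absr real_normK ?num_real//.
  by congr (_%:E); ring.
move=> y /eqP; rewrite -subr_eq0 => yp.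
have {yp} : 0 < (y - p) ^+ 2 by rewrite exprn_even_gt0.
rewrite /escale /absr real_normK ?num_real//.
have := proj2 fp y; case: (f y) => [b| |]//=.
  rewrite -EFinM -EFinD lee_fin lte_fin => H1 H2; nra.
by move=> _; rewrite gt0_muley ?lte_fin// addye ?ltry.
Qed.

Lemma prox_subgrad {R : realType} (f : R -> \bar R) (c p s z : R) :
  0 < c -> subgrad f p s -> p + c * s = z -> prox (escale c f) z = p.
Proof.
move=> c0 fp e; rewrite /prox (@Argprox_subgrad _ _ _ p s)//.
by apply: xget_subset1 => // x y -> ->.
Qed.

(** Since the slopes of [phi] are steep at both ends of its domain and vary
    continuously, [phi' s + c * s] takes every value [z >= 0]. As [phi] is
    positive away from 0, its slopes are negative on the left of 0, so that
    [z >= 0] is taken at some [s >= 0] with [phi' s >= 0]. *)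
Lemma subgrad_solve {R : realType} (phi : R -> \bar R) (c z : R) :
  (forall x, phi x != -oo%E) -> (forall x, phi (- x) = phi x) ->
  econvex (phi : R^o -> \bar R) ->
  ediff_on (interior (edom phi)) phi ->
  (forall x, phi x = 0%E <-> x = 0) ->
  steep_line phi \/ steep_segment phi -> 0 <= c -> 0 <= z ->
  exists s p, [/\ 0 <= s, 0 <= p, subgrad phi s p & p + c * s = z].
Proof.
move=> phiNy phi_even phi_cvx phi_diff phi0 steep c0 z0.
pose D := interior (edom phi).
have Dfin x : D x -> phi x \is a fin_num.
  by move=> /interior_subset /= xoo; rewrite fin_numE phiNy lt_eqF.
have Dsub x : D x -> subgrad phi x (ederiv phi x).
  by move=> Dx; apply: subgrad_ederiv; [|exact: phi_cvx|exact: Dfin|exact: phi_diff].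
have [b1 [b2 [[b10 db1] [b20 db2] bD]]] : exists b1 b2,
    [/\ b1 < 0 /\ ederiv phi b1 < 0, 0 < b2 /\ z < ederiv phi b2 &
    forall x, b1 <= x <= b2 -> D x].
  case: steep => [[domT lim1 lim2]|[a [a0 doma lim1 lim2]]].
    have /filter_ex[b1 [b10 db1]] : \forall x \near -oo%R, x < 0 /\ ederiv phi x < 0.
      near=> x; split; near: x; first exact: nbhs_ninfty_lt.
      by move/cvgrNyPlt: lim1; apply.
    have /filter_ex[b2 [b20 db2]] : \forall x \near +oo%R, 0 < x /\ z < ederiv phi x.
      near=> x; split; near: x; first exact: nbhs_pinfty_gt.
      by move/cvgryPgt: lim2; apply.
    by exists b1, b2; split=> // x _; rewrite /D domT interiorT.
  have na0 : - a < 0 by rewrite oppr_lt0.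
  have /filter_ex[b1 [ab1 b10 db1]] : \forall x \near (- a)^'+,
      [/\ - a < x, x < 0 & ederiv phi x < 0].
    near=> x; split; near: x; [exact: nbhs_right_gt|exact: nbhs_right_lt|].
    by move/cvgrNyPlt: lim1; apply.
  have /filter_ex[b2 [ab2 b20 db2]] : \forall x \near a^'-,
      [/\ x < a, 0 < x & z < ederiv phi x].
    near=> x; split; near: x; [exact: nbhs_left_lt|exact: nbhs_left_gt|].
    by move/cvgryPgt: lim2; apply.
  exists b1, b2; split=> // x /andP[b1x xb2].
  rewrite /D doma interior_itv_bnd /= in_itv /=.
  by rewrite (lt_le_trans ab1)//= (le_lt_trans xb2).
have [s] : exists2 s, s \in `[b1, b2] & ederiv phi s + c * s = z.
  apply: IVT; first exact: ltW (lt_trans b10 b20).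
    apply: continuous_subspace_itv => x; rewrite in_itv /= => xb.
    apply: cvgD; last by apply: cvgM; [exact: cvg_cst|exact: cvg_id].
    have Dx := bD _ xb.
    apply: ederiv_continuous; first exact: phi_diff.
    have : \forall y \near x, D y by exact: nbhs_interior.
    by apply: filterS => y /Dsub.
  rewrite ge_min le_max; apply/andP; split; apply/orP; [left|right]; nra.
rewrite in_itv /= => sb sz; have Ds := bD _ sb; have sub := Dsub _ Ds.
have phi00 : phi 0 = 0%E by apply/phi0.
(* 0 is the midpoint of s and - s *)
have phis : 0 <= fine (phi s).
  have := phi_cvx s (- s) 2^-1; rewrite phi_even (subgrad_fine sub).
  rewrite -!EFinM -EFinD (_ : _ + _ = 0); last first.
    by rewrite /GRing.scale /=; lra.
  rewrite phi00 lee_fin => /(_ _)/wrap[]; first by apply/andP; split; lra.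
  by lra.
have s0 : s != 0 -> 0 < fine (phi s).
  move=> s0; rewrite lt_neqAle phis andbT eq_sym; apply: contraNneq s0 => e.
  by apply/eqP/phi0; rewrite (subgrad_fine sub) e.
have ps := subgrad_le sub (_ : phi 0 \is a fin_num).
rewrite phi00 in ps; have {}ps := ps isT; rewrite /= in ps.
exists s, (ederiv phi s).
have [sn|sp|s00] := ltgtP s 0.
- by have := s0 (ltr0_neq0 sn); nra.
- split=> //.
  by rewrite -(pmulr_lge0 _ sp); lra.
- by split=> //; move: sz; rewrite s00 mulr0 addr0 => ->.
Unshelve. all: by end_near.
Qed.

(** Points [p1 = z - c1 s1] and [p2 = z - c2 s2] with slopes [s1], [s2] of the
    conjugate: as the weight [c] increases, the value of the conjugate
    decreases, at a bounded rate. *)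
Lemma resolvent_le {R : realType} {f : R -> \bar R} {c1 c2 s1 s2 p1 p2 z : R} :
  subgrad f s1 p1 -> subgrad f s2 p2 -> 0 <= s1 -> 0 <= s2 ->
  p1 + c1 * s1 = z -> p2 + c2 * s2 = z -> 0 <= c1 <= c2 -> 0 < c2 ->
  s2 <= s1 /\
  0 <= fine (fenchel f p1) - fine (fenchel f p2) <= s1 * s2 * (c2 - c1).
Proof.
move=> f1 f2 s10 s20 e1 e2 /andP[c10 c12] c20.
have mono := subgrad_mono f1 f2.
have g1 := subgrad_fenchel f1; have g2 := subgrad_fenchel f2.
have l12 := subgrad_le g1 (proj1 g2); have l21 := subgrad_le g2 (proj1 g1).
have p21 : p2 <= p1.
  rewrite leNgt; apply/negP => p12.
  have s12 : s1 <= s2 by rewrite leNgt; apply/negP => ?; nra.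
  have : c1 * s1 <= c2 * s2 by apply: ler_pM.
  by lra.
have s21 : s2 <= s1.
  rewrite leNgt; apply/negP => s12.
  have : c1 * s1 <= c2 * s1 by apply: ler_wpM2r.
  have : c2 * s1 < c2 * s2 by rewrite ltr_pM2l.
  by nra.
split=> //; apply/andP; split.
  have : 0 <= s2 * (p1 - p2) by rewrite mulr_ge0// subr_ge0.
  by lra.
have -> : s1 * s2 * (c2 - c1) = s1 * (p1 - p2) + s1 * c1 * (s1 - s2).
  have -> : p1 = z - c1 * s1 by lra.
  have -> : p2 = z - c2 * s2 by lra.
  by ring.
have : 0 <= s1 * c1 * (s1 - s2) by rewrite !mulr_ge0// subr_ge0.
by lra.
Qed.

(** The root is unique because the identity makes the left-hand side strictly
    increasing; that same term makes it nonnegative far away. *)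
Lemma exists_unique_root {R : realType} (D G : R -> R) (K gamma rho t0 : R) :
  0 < gamma ->
  (forall x, 0 < x -> {for x, continuous D}) ->
  (forall x y, 0 < x -> x <= y -> D x <= D y) ->
  (forall x y, 0 < x -> x <= y -> 0 <= G x - G y <= K * (y - x)) ->
  0 < t0 -> t0 + gamma * D t0 - rho - gamma * G t0 <= 0 ->
  exists t, [/\ 0 < t, t + gamma * D t - rho - gamma * G t = 0 &
    forall u, 0 < u -> u + gamma * D u - rho - gamma * G u = 0 -> u = t].
Proof.
move=> g0 cD mD lG t00 h0.
have K0 : 0 <= K by have := lG t0 (t0 + 1) t00; rewrite lerDl ler01 => /(_ isT); lra.
pose t1 := Num.max t0 (rho + gamma * G t0 - gamma * D t0).
have t01 : t0 <= t1 by rewrite le_max lexx.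
have t1' : rho + gamma * G t0 - gamma * D t0 <= t1 by rewrite le_max lexx orbT.
have h1 : 0 <= t1 + gamma * D t1 - rho - gamma * G t1.
  have := mD _ _ t00 t01; have /andP[+ _] := lG _ _ t00 t01; nra.
have cG x : 0 < x -> {for x, continuous G}.
  move=> x0; apply/cvgrPdist_lt => e e0.
  have e' : 0 < e / (K + 1) by rewrite divr_gt0// ltr_wpDl.
  near=> y.
  have y0 : 0 < y by near: y; exact: lt_nbhsr.
  have : `|x - y| < e / (K + 1) by near: y; exact: (@nbhsx_ballx R R x).
  rewrite ltr_pdivlMr ?ltr_wpDl// => xye.
  apply: le_lt_trans xye; have [xy|/ltW yx] := leP x y.
    have := lG _ _ x0 xy.
    rewrite (distrC x y) (ger0_norm (_ : 0 <= y - x)) ?subr_ge0// => /andP[A B].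
    by rewrite ger0_norm//; nra.
  have := lG _ _ y0 yx.
  rewrite (ger0_norm (_ : 0 <= x - y)) ?subr_ge0// => /andP[A B].
  by rewrite (distrC (G x)) ger0_norm//; nra.
have [t] : exists2 t, t \in `[t0, t1] & t + gamma * D t - rho - gamma * G t = 0.
  apply: IVT => //; last by rewrite ge_min le_max h0 h1 orbT.
  apply: continuous_subspace_itv => x; rewrite in_itv /= => /andP[xt _].
  have x0 := lt_le_trans t00 xt.
  apply: cvgB; last by apply: cvgM; [exact: cvg_cst|exact: cG].
  apply: cvgB; last exact: cvg_cst.
  apply: cvgD; first exact: cvg_id.
  by apply: cvgM; [exact: cvg_cst|exact: cD].
rewrite in_itv /= => /andP[/(lt_le_trans t00) tp _] ht; exists t; split=> // u up hu.
have incr x y : 0 < x -> x < y ->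
    x + gamma * D x - rho - gamma * G x < y + gamma * D y - rho - gamma * G y.
  move=> x0 xy; have := mD _ _ x0 (ltW xy).
  rewrite -(ler_pM2l g0); have /andP[+ _] := lG _ _ x0 (ltW xy).
  by rewrite subr_ge0 -(ler_pM2l g0); lra.
have [/(incr _ _ up)|/(incr _ _ tp)|//] := ltgtP u t; by rewrite ht hu ltxx.
Unshelve. all: by end_near.
Qed.

(** Letting the tangent point tend to 0, lower semicontinuity turns a finite
    limit slope at 0 into a subgradient at 0; in particular [f 0] is finite. *)
Lemma lim_slope_le {R : realType} (f : R -> \bar R) (l r : R) :
  lower_semicontinuous f ->
  (forall x, 0 < x -> subgrad f x (ederiv f x)) ->
  ederiv f x @[x --> 0^'+] --> l -> 0 < r ->
  (f 0%R <= (fine (f r) - l * r)%:E)%E.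
Proof.
move=> lsc fs lim r0.
have ler t : 0 < t -> l <= ederiv f t.
  move=> t0; rewrite leNgt; apply/negP => tl.
  have /filter_ex[x [x0 xt tx]] : \forall x \near 0^'+,
      [/\ 0 < x, x < t & ederiv f t < ederiv f x].
    near=> x; split; near: x; [exact: nbhs_right_gt|exact: nbhs_right_lt|].
    exact: (cvgr_gt _ lim).
  by have := subgrad_mono (fs _ x0) (fs _ t0); nra.
rewrite leNgt; apply/negP => lt0.
have [a [lta af]] : exists a, fine (f r) - l * r < a /\ (a%:E < f 0%R)%E.
  case f0E: (f 0) lt0 => [b| |]//=.
    rewrite lte_fin => lb; exists ((fine (f r) - l * r + b) / 2).
    by rewrite lte_fin; split; lra.
  by move=> _; exists (fine (f r) - l * r + 1); rewrite ltry; split; lra.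
have [V V0 HV] := lsc _ _ af.
have /filter_ex[t [t0 tr Vt tl]] : \forall t \near 0^'+,
   [/\ 0 < t, t < r, V t & fine (f r) - l * r + l * t < a].
  near=> t; split; near: t; [exact: nbhs_right_gt|exact: nbhs_right_lt| |].
    exact: cvg_within V0.
  have lin : (fun t => fine (f r) - l * r + l * t) t @[t --> 0^'+] -->
      fine (f r) - l * r + l * 0.
    apply: cvgD; first exact: cvg_cst.
    by apply: cvgM; [exact: cvg_cst|exact: cvg_within].
  by apply: (cvgr_lt _ lin); rewrite mulr0 addr0.
have sub := fs _ t0; have := HV _ Vt; rewrite (subgrad_fine sub) lte_fin.
have := subgrad_le sub (proj1 (fs _ r0)).
have := ler _ t0; nra.
Unshelve. all: by end_near.
Qed.

(** * Euclidean geometry of row vectors *)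

(** The Euclidean inner product. *)
Definition dotv {R : realType} {d : nat} (a b : 'rV[R]_d) : R :=
  \sum_(i < d) a ord0 i * b ord0 i.

Lemma l2norm_ge0 {R : realType} {d : nat} (a : 'rV[R]_d) : 0 <= l2norm a.
Proof. exact: sqrtr_ge0. Qed.

Lemma l2norm0 {R : realType} {d : nat} : l2norm (0 : 'rV[R]_d) = 0.
Proof. by rewrite /l2norm big1 ?sqrtr0// => i _; rewrite mxE expr0n. Qed.

Lemma dotv0l {R : realType} {d : nat} (a : 'rV[R]_d) : dotv 0 a = 0.
Proof. by rewrite /dotv big1// => i _; rewrite mxE mul0r. Qed.

Lemma sqr_l2norm {R : realType} {d : nat} (a : 'rV[R]_d) : l2norm a ^+ 2 = dotv a a.
Proof. by rewrite sqr_sqrtr// sumr_ge0// => i _; rewrite sqr_ge0. Qed.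

Lemma l2norm_eq0 {R : realType} {d : nat} (a : 'rV[R]_d) : l2norm a = 0 -> a = 0.
Proof.
move=> a0; have := sqr_l2norm a; rewrite a0 expr0n /= => /esym/psumr_eq0P H.
apply/rowP => i; rewrite mxE; apply/eqP; rewrite -[_ == _]orbb -mulf_eq0.
by apply/eqP/H => // j _; rewrite -expr2 sqr_ge0.
Qed.

Lemma sqr_l2normB {R : realType} {d : nat} (a b : 'rV[R]_d) (k : R) :
  l2norm (a - k *: b) ^+ 2 = l2norm a ^+ 2 - 2 * k * dotv a b + k ^+ 2 * l2norm b ^+ 2.
Proof.
rewrite !sqr_l2norm /dotv !mulr_sumr -sumrB -big_split /=.
by apply: eq_bigr => i _; rewrite !mxE; ring.
Qed.

Lemma dotv_le {R : realType} {d : nat} (a b : 'rV[R]_d) :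
  dotv a b <= l2norm a * l2norm b.
Proof.
have [b0|b0] := eqVneq (l2norm b) 0.
  rewrite b0 mulr0 /dotv (l2norm_eq0 _ b0) big1// => i _.
  by rewrite mxE mulr0.
have b1 : 0 < l2norm b by rewrite lt_neqAle eq_sym b0 l2norm_ge0.
have := sqr_ge0 (l2norm (a - (dotv a b / l2norm b ^+ 2) *: b)).
rewrite sqr_l2normB.
have -> : l2norm a ^+ 2 - 2 * (dotv a b / l2norm b ^+ 2) * dotv a b +
   (dotv a b / l2norm b ^+ 2) ^+ 2 * l2norm b ^+ 2 =
   l2norm a ^+ 2 - dotv a b ^+ 2 / l2norm b ^+ 2 by field.
rewrite subr_ge0 ler_pdivrMr ?exprn_gt0// -exprMn => H.
have ab0 : 0 <= l2norm a * l2norm b by rewrite mulr_ge0 ?l2norm_ge0.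
rewrite (le_trans (ler_norm _))// -sqrtr_sqr -(ger0_norm ab0).
by rewrite -sqrtr_sqr ler_sqrt// sqr_ge0.
Qed.

Lemma sqr_l2norm_pair {R : realType} {d : nat} (p : R * 'rV[R]_d) :
  l2norm_pair p ^+ 2 = p.1 ^+ 2 + l2norm p.2 ^+ 2.
Proof. by rewrite sqr_sqrtr// addr_ge0 ?sqr_ge0. Qed.

(** * The perspective function and the optimality conditions *)

(** Fenchel-Young for [phi] at [|m| / rho], scaled by [rho]; [Phi_subgrad] is its
    equality case. *)
Lemma Phi_ge {R : realType} {d : nat} (phi : R -> \bar R) (p : R)
    (q : R * 'rV[R]_d) : fenchel phi p \is a fin_num ->
  (forall x, phi x != -oo%E) ->
  ((p * l2norm q.2 - q.1 * fine (fenchel phi p))%:E <= Phi phi q)%E.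
Proof.
move=> fp phiNy; rewrite /Phi; case: ifPn => [q0|_].
  have := fenchel_young phi (l2norm q.2 / q.1) p.
  move: (phiNy (l2norm q.2 / q.1)); case: (phi _) => [b| |]//= _.
    move=> /(_ isT); rewrite -(fineK fp) -EFinM !lee_fin.
    have -> : p * l2norm q.2 = q.1 * (p * (l2norm q.2 / q.1)).
      by field; rewrite gt_eqF.
    by rewrite -mulrBr ler_pM2l//; lra.
  by rewrite gt0_muley ?lte_fin// leey.
case: eqP => [->|_]; last by rewrite leey.
by rewrite /= mul0r subr0 l2norm0 mulr0.
Qed.

Lemma Phi_subgrad {R : realType} {d : nat} (phi : R -> \bar R) (p s : R)
    (q : R * 'rV[R]_d) : subgrad phi s p -> 0 < q.1 -> l2norm q.2 = q.1 * s ->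
  Phi phi q = (p * l2norm q.2 - q.1 * fine (fenchel phi p))%:E.
Proof.
move=> sp q0 qs; rewrite /Phi q0 (fenchel_subgrad sp) qs.
rewrite mulrAC mulfV ?gt_eqF// mul1r (subgrad_fine sp) -EFinM /=.
by congr (_%:E); ring.
Qed.

Lemma objective_ge {R : realType} (gamma a b c : R) (f g : \bar R) :
  0 < gamma -> (a%:E <= f)%E -> (b%:E <= g)%E ->
  ((gamma * (a + b) + c)%:E <= gamma%:E * (f + g) + c%:E)%E.
Proof.
move=> g0 af bg; rewrite EFinD leeD2r// EFinM lee_pmul2l ?lte_fin//.
by rewrite EFinD leeD.
Qed.

(** First-order conditions: a point (theta, lambda m) is the proximal point as
    soon as [p] is a slope of [phi] at [|lambda m| / theta], [D] is a slope of
    [F] at [theta], and the two components of the gradient of the quadratic term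
    balance [p] and [D - phi^* p]. *)
Lemma Argprox_interior {R : realType} {d : nat} (F phi : R -> \bar R)
    (gamma rho theta D p s lambda : R) (m : 'rV[R]_d) :
  (forall x, phi x != -oo%E) ->
  subgrad phi s p -> subgrad F theta D -> 0 < gamma -> 0 < theta ->
  lambda <= 1 ->
  l2norm (lambda *: m) = theta * s -> lambda * l2norm m = theta * s ->
  (1 - lambda) * l2norm m = gamma * p ->
  theta + gamma * D - rho - gamma * fine (fenchel phi p) = 0 ->
  Argprox l2norm_pair (escale gamma (fun q => Phi phi q + Psi F q)%E) (rho, m) =
    [set (theta, lambda *: m)].
Proof.
move=> phiNy sp sF g0 th0 lam1 vs ws wp opt.
set g := fine (fenchel phi p) in opt *.
have gfin : fenchel phi p \is a fin_num by rewrite (fenchel_subgrad sp).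
(* the minorant of the objective built from the affine minorants of slope p and D *)
pose B (q : R * 'rV[R]_d) := gamma * (p * l2norm q.2 - q.1 * g +
  (fine (F theta) + D * (q.1 - theta))) + 2^-1 * l2norm_pair (q - (rho, m)) ^+ 2.
apply: (argmin_set1 _ _ (B (theta, lambda *: m))).
  rewrite /escale (@Phi_subgrad _ _ _ p s)//= /Psi /= (subgrad_fine sF).
  by rewrite /B /= subrr mulr0 addr0 EFinD EFinM EFinD.
move=> [r n] ne; apply: (@lt_le_trans _ _ (B (r, n))%:E); last first.
  apply: objective_ge => //; last by apply: (proj2 sF).
  exact: (@Phi_ge _ _ phi _ (r, n) gfin phiNy).
rewrite lte_fin /B !sqr_l2norm_pair /=.
rewrite (_ : lambda *: m - m = (lambda - 1) *: m); last by rewrite scalerBl scale1r.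
rewrite (_ : n - m = n - 1 *: m); last by rewrite scale1r.
have pos : 0 < (r - theta) ^+ 2 + l2norm (n - lambda *: m) ^+ 2.
  have [rt|rt] := eqVneq r theta.
    rewrite rt subrr expr0n add0r lt_neqAle sqr_ge0 andbT eq_sym expf_eq0 /=.
    apply/eqP => /l2norm_eq0/subr0_eq nv; apply: ne.
    by rewrite rt nv.
  by rewrite ltr_pwDl ?sqr_ge0// exprn_even_gt0// subr_eq0.
have dle := dotv_le n m.
rewrite !sqr_l2normB in pos *.
have -> : l2norm ((lambda - 1) *: m) ^+ 2 = ((1 - lambda) * l2norm m) ^+ 2.
  have := sqr_l2normB 0 m (1 - lambda); rewrite sub0r -scaleNr opprB => ->.
  by rewrite l2norm0 dotv0l; ring.
rewrite vs -ws wp.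
move: (l2norm n) (l2norm m) (dotv n m) pos dle wp => N w de pos dle wp.
have {}dle : (1 - lambda) * de <= gamma * p * N.
  by rewrite -wp -mulrA (mulrC w) ler_wpM2l// subr_ge0.
have -> : gamma * (p * (lambda * w) - theta * g +
      (fine (F theta) + D * (theta - theta))) =
    gamma * (p * (lambda * w) - r * g + (fine (F theta) + D * (r - theta))) +
      (r - theta) * (theta - rho).
  have -> : rho = theta + gamma * D - gamma * g by lra.
  by ring.
have e : (gamma * p) ^+ 2 = ((1 - lambda) * w) ^+ 2 by rewrite wp.
have e2 : gamma * p * (lambda * w) = (1 - lambda) * w * (lambda * w) by rewrite wp.
rewrite e; nra.
Qed.

(** Below the threshold, Fenchel-Young with the slope [|m| / gamma] shows that
    the origin is the proximal point. *)
Lemma Argprox_origin {R : realType} {d : nat} (F phi : R -> \bar R)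
    (gamma rho l : R) (m : 'rV[R]_d) :
  (forall x, phi x != -oo%E) -> fenchel phi (l2norm m / gamma) \is a fin_num ->
  F 0 \is a fin_num ->
  (forall r, 0 < r -> ((fine (F 0%R) + l * r)%:E <= F r)%E) ->
  (forall x, F x != -oo%E) ->
  0 < gamma -> rho + gamma * fine (fenchel phi (l2norm m / gamma)) <= gamma * l ->
  Argprox l2norm_pair (escale gamma (fun q => Phi phi q + Psi F q)%E) (rho, m) =
    [set (0, 0)].
Proof.
move=> phiNy gfin F0 Fr FNy g0; set g := fine _ => opt.
apply: (argmin_set1 _ _ (gamma * fine (F 0) +
    2^-1 * l2norm_pair ((0, 0) - (rho, m)) ^+ 2)).
  rewrite /escale /Phi /Psi /= ltxx eqxx add0e -(fineK F0) /=.
  by rewrite -EFinM -EFinD.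
move=> [r n] ne; have [r0|r0] := ltP 0 r; last first.
  rewrite /escale /Phi /Psi /= (le_gtF r0).
  case: eqP => [//|_].
  by rewrite addye ?FNy// gt0_muley ?lte_fin// addye// ltry.
pose B := gamma * (l2norm m / gamma * l2norm n - r * g + (fine (F 0) + l * r)) +
  2^-1 * l2norm_pair ((r, n) - (rho, m)) ^+ 2.
apply: (@lt_le_trans _ _ B%:E); last first.
  apply: objective_ge => //; last exact: Fr.
  exact: (@Phi_ge _ _ phi _ (r, n) gfin phiNy).
rewrite lte_fin /B !sqr_l2norm_pair /= -(scale1r m) !sqr_l2normB scale1r l2norm0 dotv0l.
have := dotv_le n m; move: (l2norm n) (dotv n m) => N de dle.
have -> : gamma * (l2norm m / gamma * N - r * g + (fine (F 0) + l * r)) =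
    l2norm m * N + gamma * fine (F 0) + r * (gamma * l - gamma * g).
  by field; rewrite gt_eqF.
have : 0 <= r * (gamma * l - gamma * g - rho) by rewrite mulr_ge0; lra.
have := sqr_ge0 N; have : 0 < r ^+ 2 by rewrite exprn_gt0.
nra.
Qed.

(** The derivative of [gamma F + |. - rho|^2 / 2] is nonnegative at [theta], so
    its minimizer lies to the left of [theta]. *)
Lemma prox_bounds {R : realType} (F : R -> \bar R) (gamma rho theta D : R) :
  0 < gamma -> 0 < theta -> subgrad F theta D -> 0 <= theta + gamma * D - rho ->
  (forall x, x < 0 -> F x = +oo%E) ->
  0 <= prox (escale gamma F) rho <= theta.
Proof.
move=> g0 th0 sF opt Foo; rewrite /prox.
(* the default value of prox, 0, satisfies the bounds too *)
case: xgetP => [q _ /(_ theta)|_]; last by rewrite lexx ltW.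
rewrite /escale /absr !real_normK ?num_real// (subgrad_fine sF) -EFinM -EFinD => qle.
have q0 : 0 <= q.
  rewrite leNgt; apply/negP => /Foo qoo.
  by move: qle; rewrite qoo gt0_muley ?lte_fin// addye.
rewrite q0 leNgt; apply/negP => thq.
have := proj2 sF q; move: qle; case: (F q) => [b| |]//=.
  rewrite -EFinM -EFinD !lee_fin => A B.
  have : gamma * (fine (F theta) + D * (q - theta)) <= gamma * b by rewrite ler_pM2l.
  have : 0 < (q - theta) ^+ 2 by rewrite exprn_gt0// subr_gt0.
  have : 0 <= (theta + gamma * D - rho) * (q - theta).
    by rewrite mulr_ge0// ltW// subr_gt0.
  by nra.
by rewrite gt0_muley ?lte_fin// addye.
Qed.

(** A point of the domain on the left of 0 would, by convexity, put a whole
    neighbourhood of negative numbers into the domain. *)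
Lemma econvex_lt0_pinfty {R : realType} (F : R -> \bar R) (x : R) :
  (forall x, F x != -oo%E) -> econvex (F : R^o -> \bar R) ->
  interior (edom F) = `]0, +oo[%classic -> x < 0 -> F x = +oo%E.
Proof.
move=> FNy Fcvx Fdom x0.
case Fx: (F x) => [b| |]//; last by move: (FNy x); rewrite Fx.
have : interior (edom F) (x / 2).
  have : \forall y \near x / 2, y \in `]x, 0[.
    by apply: near_in_itvoo; rewrite in_itv /=; lra.
  apply: filterS => y; rewrite in_itv /= => /andP[xy y0].
  have F1 : edom F 1 by apply: interior_subset; rewrite Fdom /= in_itv /= ltr01.
  have x1 : 0 < 1 - x by lra.
  have t01 : 0 <= (1 - y) / (1 - x) <= 1.
    by rewrite ler_pdivlMr// ler_pdivrMr//; apply/andP; split; lra.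
  have := Fcvx x 1 _ t01.
  rewrite (_ : _ *: _ + _ *: _ = y); last first.
    by rewrite /GRing.scale /=; field; rewrite gt_eqF.
  move=> /le_lt_trans; apply; move: F1 (FNy 1); rewrite Fx /edom /=.
  by case: (F 1) => [c| |]// _ _; rewrite -!EFinM -EFinD ltry.
by rewrite Fdom /= in_itv /= andbT pmulr_lgt0// ltNge (ltW x0).
Qed.

(** * The threshold and the residual *)

(** The real bound [b'] separates the limit from [b], so that a definite gap
    remains also when the limit is [-oo]. *)
Lemma slope_lt_near0 {R : realType} (f : R -> R) (L : \bar R) (b : R) :
  (f x)%:E @[x --> (0 : R)^'+] --> L -> (L < b%:E)%E ->
  exists2 b', b' < b & \forall x \near 0^'+, f x < b'.
Proof.
case: L => [l| |]// lim; last first.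
  move=> _; exists (b - 1); first by rewrite gtrBl.
  by move/cvgeNyPlt: lim => /(_ (b - 1)); apply: filterS => x; rewrite lte_fin.
rewrite lte_fin => lb; exists ((l + b) / 2); first by lra.
by have /fine_cvgP[_ lim'] := lim; apply: (cvgr_lt _ lim'); lra.
Qed.

Local Open Scope ereal_scope.

Theorem proposition4p1 (R : realType) (d : nat) (hd : (0 < d)%N)
  (F : R -> \bar R)
  (F_gtNy : forall x, F x != -oo)
  (F_lsc : lower_semicontinuous F)
  (F_convex : econvex (F : R^o -> \bar R))
  (F_dom : interior (edom F) = `]0%R, +oo[%classic)
  (F_diff : ediff_on `]0%R, +oo[%classic F)
  (L0 : \bar R)
  (L0_lim : (ederiv F x)%:E @[x --> (0 : R)%R^'+] --> L0)
  (L0_lty : L0 < +oo)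
  (phi : R -> \bar R)
  (phi_gtNy : forall x, phi x != -oo)
  (phi_even : forall x, phi (- x)%R = phi x)
  (phi_convex : econvex (phi : R^o -> \bar R))
  (phi_lsc : lower_semicontinuous phi)
  (phi_diff : ediff_on (interior (edom phi)) phi)
  (phi_eq0 : forall x, phi x = 0 <-> x = 0%R)
  (phi_steep : steep_line phi \/ steep_segment phi)
  (gamma : R) (hgamma : (0 < gamma)%R)
  (rho : R) (m : 'rV[R]_d) :
  let z := (l2norm m / gamma)%R in
  let P := Argprox l2norm_pair
             (escale gamma (fun p => Phi phi p + Psi F p)) (rho, m) in
  (rho%:E + gamma%:E * fenchel phi z <= gamma%:E * L0 ->
     P = [set (0%R, 0%R)])
  /\
  (gamma%:E * L0 < rho%:E + gamma%:E * fenchel phi z ->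
     exists theta : R,
     [/\ (0 <= prox (escale gamma F) rho <= theta)%R,
         (0 < theta)%R /\ residual F phi gamma rho z theta = 0,
         (forall t, (0 < t)%R -> residual F phi gamma rho z t = 0 -> t = theta)
       & let v := if m == 0%R then 0%R else
                    ((1 - gamma / l2norm m *
                        prox (escale (theta / gamma) (fenchel phi)) z) *: m)%R in
         P = [set (theta, v)]]).
Proof.
move=> z P.
have z0 : (0 <= z)%R by rewrite divr_ge0 ?l2norm_ge0// ltW.
have Fsub x : (0 < x)%R -> subgrad F x (ederiv F x).
  move=> x0; have Dx : `]0%R, +oo[%classic x by rewrite /= in_itv /= x0.
  apply: subgrad_ederiv => //; last exact: F_diff.
  rewrite fin_numE F_gtNy lt_eqF//.
  by move: Dx; rewrite -F_dom => /interior_subset.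
have path c : (0 <= c)%R -> exists s p,
    [/\ (0 <= s)%R, (0 <= p)%R, subgrad phi s p & (p + c * s)%R = z].
  by move=> c0; exact: subgrad_solve.
(* at c = 0 the slope is z itself *)
have [s0 [p0 [s00 _ sub0]]] := path 0%R (lexx _).
rewrite mul0r addr0 => p0z; rewrite {p0}p0z in sub0.
have [g fz] : exists g, fenchel phi z = g%:E.
  by rewrite (fenchel_subgrad sub0); eexists.
rewrite fz -EFinM -EFinD; split=> thr.
  have [l L0E] : exists l, L0 = l%:E.
    case: L0 L0_lty thr {L0_lim} => [l| |]//; first by exists l.
    by move=> _; rewrite gt0_muleNy ?lte_fin.
  move: L0_lim thr; rewrite L0E -EFinM lee_fin => /fine_cvgP[_ lim] thr.
  have F0le r : (0 < r)%R -> F 0%R <= (fine (F r) - l * r)%:E by exact: lim_slope_le.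
  have F0 : F 0%R \is a fin_num.
    by rewrite fin_numE F_gtNy lt_eqF// (le_lt_trans (F0le _ ltr01)) ?ltry.
  apply: (@Argprox_origin _ _ _ _ _ _ l) => //; rewrite -/z ?fz// => r r0.
  have := F0le _ r0; rewrite -(fineK F0) (subgrad_fine (Fsub _ r0)) !lee_fin /=.
  by rewrite lerBrDr.
have spec t : (0 < t)%R -> exists s p, [/\ (0 <= s)%R, (0 <= p)%R, subgrad phi s p,
    (p + t / gamma * s)%R = z & prox (escale (t / gamma) (fenchel phi)) z = p].
  move=> t0; have tg : (0 < t / gamma)%R by rewrite divr_gt0.
  have [s [p [s1 p1 sp e]]] := path _ (ltW tg); exists s, p; split=> //.
  exact: prox_subgrad tg (subgrad_fenchel sp) e.
pose G t := fine (fenchel phi (prox (escale (t / gamma) (fenchel phi)) z)).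
have resE t : (0 < t)%R ->
    residual F phi gamma rho z t = (t + gamma * ederiv F t - rho - gamma * G t)%:E.
  move=> t0; have [s [p [_ _ sp _ pE]]] := spec _ t0.
  by rewrite /residual /G pE (fenchel_subgrad sp).
have e0 : (z + 0 * s0 = z)%R by rewrite mul0r addr0.
(* s0 bounds the slopes s for all weights t / gamma, whence the constant
   s0 ^ 2 / gamma *)
have G_z t : (0 < t)%R -> (g - G t <= s0 ^+ 2 / gamma * t)%R.
  move=> t0; have [s [p [s1 _ sp e pE]]] := spec _ t0.
  have tg : (0 < t / gamma)%R by rewrite divr_gt0.
  have tg' : (0 <= 0 :> R)%R && (0 <= t / gamma)%R by rewrite lexx ltW.
  have [ss /andP[_]] := resolvent_le sub0 sp s00 s1 e0 e tg' tg.
  rewrite fz /= -pE -/(G t) subr0 => /le_trans; apply.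
  rewrite (_ : s0 ^+ 2 / gamma * t = s0 * s0 * (t / gamma))%R; last by ring.
  by rewrite ler_wpM2r ?(ltW tg)// ler_wpM2l.
have G_lip x y : (0 < x)%R -> (x <= y)%R ->
    (0 <= G x - G y <= s0 ^+ 2 / gamma * (y - x))%R.
  move=> x0 xy; have y0 := lt_le_trans x0 xy.
  have [s1 [p1 [s10 _ sp1 e1 p1E]]] := spec _ x0.
  have [s2 [p2 [s20 _ sp2 e2 p2E]]] := spec _ y0.
  have xg : (0 < x / gamma)%R by rewrite divr_gt0.
  have yg : (0 < y / gamma)%R by rewrite divr_gt0.
  have xg' : (0 <= 0 :> R)%R && (0 <= x / gamma)%R by rewrite lexx ltW.
  have xyg : (0 <= x / gamma <= y / gamma)%R by rewrite ltW// ler_pM2r ?invr_gt0.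
  have [ss1 _] := resolvent_le sub0 sp1 s00 s10 e0 e1 xg' xg.
  have [ss2 /andP[A B]] := resolvent_le sp1 sp2 s10 s20 e1 e2 xyg yg.
  rewrite /G p1E p2E A; apply: (le_trans B).
  rewrite (_ : s0 ^+ 2 / gamma * (y - x) =
      s0 * s0 * (y / gamma - x / gamma))%R; last by ring.
  by rewrite ler_wpM2r ?subr_ge0 ?ler_pM2r ?invr_gt0// ler_pM// (le_trans ss2).
have F_mono x y : (0 < x)%R -> (x <= y)%R -> (ederiv F x <= ederiv F y)%R.
  move=> x0; rewrite le_eqVlt => /predU1P[->//|xy].
  have := subgrad_mono (Fsub _ x0) (Fsub _ (lt_trans x0 xy)).
  by rewrite nmulr_lge0 ?subr_le0 ?subr_lt0.
have F_cont x : (0 < x)%R -> {for x, continuous (ederiv F)}.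
  move=> x0; apply: ederiv_continuous; first by apply: F_diff; rewrite /= in_itv /= x0.
  near=> y; apply: Fsub; near: y; exact: lt_nbhsr.
(* near 0, G t is at least g - O(t) while F' stays below (rho + gamma g) / gamma *)
have [t0 t00 ht0] : exists2 t0, (0 < t0)%R &
    (t0 + gamma * ederiv F t0 - rho - gamma * G t0 <= 0)%R.
  have Lb : L0 < ((rho + gamma * g) / gamma)%:E.
    by rewrite -(@lte_pmul2l _ gamma%:E) ?lte_fin// -EFinM mulrC divfK ?gt_eqF.
  have [b' bb near_b] := slope_lt_near0 _ _ _ L0_lim Lb.
  rewrite ltr_pdivlMr// in bb.
  have K1 : (0 < 1 + s0 ^+ 2)%R by rewrite ltr_pwDl ?sqr_ge0.
  have /filter_ex[t [tp tb tl]] : \forall t \near 0^'+, [/\ (0 < t)%R,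
      (ederiv F t < b')%R & (t < (rho + gamma * g - b' * gamma) / (1 + s0 ^+ 2))%R].
    near=> t; split; near: t; [exact: nbhs_right_gt|exact: near_b|].
    by apply: nbhs_right_lt; rewrite divr_gt0// subr_gt0.
  exists t => //; rewrite ltr_pdivlMr// in tl.
  have := G_z _ tp; rewrite -(ler_pM2l hgamma) (_ : gamma * (_ * t) = s0 ^+ 2 * t)%R.
    have : (gamma * ederiv F t < gamma * b')%R by rewrite ltr_pM2l.
    by lra.
  by rewrite -mulrA mulrCA (mulrA gamma) mulfV ?gt_eqF// mul1r.
have [theta [th0 hth uth]] :=
  exists_unique_root _ _ _ _ _ _ hgamma F_cont F_mono G_lip t00 ht0.
have [s [p [s1 p1 sp e pE]]] := spec _ th0.
have Gp : G theta = fine (fenchel phi p) by rewrite /G pE.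
exists theta; split.
- apply: (@prox_bounds _ _ _ _ _ (ederiv F theta)) => //; first exact: Fsub.
    move/subr0_eq: hth => ->.
    rewrite mulr_ge0// ?(ltW hgamma)// Gp (fenchel_subgrad sp) /= subr_ge0.
    have phi0 : phi 0%R = 0 by apply/phi_eq0.
    have := subgrad_le sp (_ : phi 0%R \is a fin_num).
    by rewrite phi0 /= sub0r mulrN subr_le0 => /(_ isT).
  by move=> x; exact: econvex_lt0_pinfty.
- by split=> //; rewrite resE// hth.
- by move=> t tp; rewrite resE// => -[]; exact: uth.
move=> v; pose lambda := (if m == 0%R then 0 else 1 - gamma / l2norm m * p)%R.
have -> : v = (lambda *: m)%R.
  by rewrite /v /lambda pE; case: ifPn => // _; rewrite scale0r.
(* the slope equation p + theta / gamma * s = z, cleared of denominators *)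
have e' : (gamma * p + theta * s)%R = l2norm m.
  rewrite -[RHS](divfK (_ : gamma != 0%R)) ?gt_eqF// -/z -e.
  by field; rewrite gt_eqF.
have [ws wp lam] : [/\ (lambda * l2norm m = theta * s)%R,
    ((1 - lambda) * l2norm m = gamma * p)%R & (0 <= lambda <= 1)%R].
  rewrite /lambda; have [m0|m0] := eqVneq m 0%R.
    have gp : (0 <= gamma * p)%R by rewrite mulr_ge0// ltW.
    have ts : (0 <= theta * s)%R by rewrite mulr_ge0// ltW.
    have n0 : l2norm m = 0%R by rewrite m0 l2norm0.
    move/eqP: e'; rewrite n0 paddr_eq0// => /andP[/eqP-> /eqP->].
    by rewrite !mulr0 lexx ler01.
  have n0 : (0 < l2norm m)%R.
    rewrite lt_neqAle l2norm_ge0 andbT eq_sym.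
    by apply: contraNneq m0 => /l2norm_eq0 ->.
  have lE : ((1 - gamma / l2norm m * p) * l2norm m = theta * s)%R.
    by rewrite -[in RHS](addKr (gamma * p)%R (theta * s)%R) e'; field; rewrite gt_eqF.
  split=> //; first by rewrite mulrBl mul1r lE -e' addrK.
  apply/andP; split; first by rewrite -(pmulr_lge0 _ n0) lE mulr_ge0// ltW.
  by rewrite lerBlDr lerDl mulr_ge0// divr_ge0 ?ltW.
have vs : l2norm (lambda *: m) = (theta * s)%R.
  rewrite -ws /l2norm (eq_bigr (fun i => lambda ^+ 2 * m ord0 i ^+ 2)%R) => [|i _].
    by rewrite -mulr_sumr sqrtrM ?sqr_ge0// sqrtr_sqr ger0_norm//; case/andP: lam.
  by rewrite mxE exprMn.
apply: (@Argprox_interior _ _ _ _ _ _ _ (ederiv F theta) p s) => //; first exact: Fsub.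
  by case/andP: lam.
by rewrite -Gp.
Unshelve. all: by end_near.
Qed.
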